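(* Let $\mathbb{K}=\mathbb{R}$ or $\mathbb{C}$, let $E$ be an infinite-dimensional Banach space over $\mathbb{K}$, and let $H=\ell_2(\Gamma)$ (over $\mathbb{K}$), where $\Gamma$ is a set with $\mathrm{card}(\Gamma)>\mathfrak{c}$ and $\dim E<\mathrm{card}(\Gamma)$. If $\mathcal{L}(E;H)\setminus\Pi_1(E;H)$ is non-void, then it is $(\alpha,\mathrm{card}(\Gamma))$-lineable in $\mathcal{L}(E;H)$ for every cardinal $\alpha<\mathrm{card}(\Gamma)$.
   Context: $\mathfrak{c}$ denotes the cardinality of the continuum. For a vector space $V$, $\dim V$ denotes its algebraic (Hamel) dimension, a cardinal number. $\mathcal{L}(E;H)$ is the vector space of all continuous linear operators from $E$ to $H$. A continuous linear operator $T:E\to F$ between Banach spaces over $\mathbb{K}$ is absolutely summing if $\sum_{j}\|T(x_j)\|<\infty$ for every sequence $(x_j)_{j=1}^\infty$ in $E$ such that $\sum_{j}|\varphi(x_j)|<\infty$ for all continuous linear functionals $\varphi:E\to\mathbb{K}$; $\Pi_1(E;F)$ denotes the space of all absolutely summing operators from $E$ to $F$. For a cardinal $\beta$, a subset $A$ of a vector space $V$ is $\beta$-lineable in $V$ if $A\cup\{0\}$ contains a $\beta$-dimensional linear subspace of $V$. For cardinals $\alpha<\beta$, $A$ is $(\alpha,\beta)$-lineable in $V$ if $A$ is $\alpha$-lineable in $V$ and for every linear subspace $W_\alpha\subset V$ with $W_\alpha\subset A\cup\{0\}$ and $\dim W_\alpha=\alpha$ there is a linear subspace $W_\beta\subset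 V$ with $\dim W_\beta=\beta$ and $W_\alpha\subset W_\beta\subset A\cup\{0\}$. *)

(* Defs.v *)
From HB Require Import structures.
From mathcomp Require Import all_boot all_order all_algebra finmap.
From mathcomp Require Import ring.
From mathcomp Require Import all_classical all_reals all_analysis.
From mathcomp.real_closed Require Import complex.

Set Implicit Arguments.
Unset Strict Implicit.
Unset Printing Implicit Defensive.

Import Order.TTheory GRing.Theory Num.Theory.
Import numFieldNormedType.Exports.

Local Open Scope classical_set_scope.
Local Open Scope card_scope.
Local Open Scope ring_scope.

(* A cardinal is represented by any set (or type) of that cardinality. *)
Definition card_lt (T U : Type) (A : set T) (B : set U) : Prop :=
  A #<= B /\ A #!= B.

Section lineability.
Variables (K : fieldType) (V : lmodType K).
Implicit Types (W A B : set V).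

Definition lin_independent B : Prop :=
  forall (F : {fset V}) (c : V -> K), [set` F] `<=` B ->
    \sum_(x <- F) c x *: x = 0 -> forall x, x \in F -> c x = 0.

Definition lin_span B : set V :=
  [set v | exists (F : {fset V}) (c : V -> K),
     [set` F] `<=` B /\ v = \sum_(x <- F) c x *: x].

Definition hamel_basis W B : Prop :=
  lin_independent B /\ lin_span B = W.

Definition subspace W : Prop := submod_closed [in W].

Definition has_dim W (I : Type) : Prop :=
  exists2 B, hamel_basis W B & B #= [set: I].

Definition lineable (I : Type) A : Prop :=
  exists W, [/\ subspace W, has_dim W I & W `<=` A `|` [set 0]].

(* (card I, card J)-lineability, meant for card I < card J *)
Definition lineable2 (I J : Type) A : Prop :=
  lineable I A /\
  forall W, subspace W -> W `<=` A `|` [set 0] -> has_dim W I ->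
    exists W', [/\ subspace W', has_dim W' J, W `<=` W' &
                   W' `<=` A `|` [set 0]].

End lineability.

Definition infinite_dim (K : fieldType) (V : lmodType K) : Prop :=
  ~ exists2 B : set V, hamel_basis [set: V] B & finite_set B.

Definition dim_lt (K : fieldType) (V : lmodType K) (J : Type) : Prop :=
  exists2 B : set V, hamel_basis [set: V] B & card_lt B [set: J].

Section continuous_linear.
Variables (K : numFieldType) (E F : normedModType K).

Definition contlin_pred : {pred E -> F} :=
  [in [set f : E -> F | linear f /\ continuous f]].

Lemma contlin_submod_closed : submod_closed contlin_pred.
Proof.
split=> [|a f g]; rewrite !inE /=.
  by split=> [c u v|]; [rewrite scaler0 addr0 | exact: cst_continuous].
move=> [lf cf] [lg cg]; split=> [c u v|x].
  rewrite !fctE /= lf lg !scalerDr !scalerA (mulrC a c) addrACA; congr (_ + _).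
apply: cvgD; last exact: cg.
by apply: cvgZl_tmp; exact: cf.
Qed.

HB.instance Definition _ :=
  GRing.isSubmodClosed.Build K (E -> F) contlin_pred contlin_submod_closed.

Record contlin := ContLin { contlin_val :> E -> F;
                            contlin_valP : contlin_val \in contlin_pred }.

HB.instance Definition _ := [isSub for contlin_val].
HB.instance Definition _ := [Choice of contlin by <:].
HB.instance Definition _ := [SubChoice_isSubLmodule of contlin by <:].

End continuous_linear.

Section contlin_theory.
Variables (K : numFieldType) (E F : normedModType K).
Implicit Types T : contlin E F.

Lemma contlin_linear T : linear T.
Proof. by have := contlin_valP T; rewrite inE => -[]. Qed.

Lemma contlin_continuous T : continuous T.
Proof. by have := contlin_valP T; rewrite inE => -[]. Qed.

HB.instance Definition _ T :=
  GRing.isLinear.Build K E F *:%R (T : E -> F) (contlin_linear T).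

Definition absolutely_summing T : Prop :=
  forall x : nat -> E,
    (forall phi : contlin E K^o, cvgn (series (fun j => `|phi (x j)|))) ->
    cvgn (series (fun j => `|T (x j)|)).

Definition Pi1 : set (contlin E F) := [set T | absolutely_summing T].

End contlin_theory.

Variant scalar_kind := RealScalars | ComplexScalars.

Definition scalar_field (R : realType) (k : scalar_kind) : numFieldType :=
  match k with RealScalars => R | ComplexScalars => R[i] end.

(* Norms over [numFieldType]s take their values in the field of scalars itself,
   hence the need for this embedding. *)
Definition of_real (R : realType) (k : scalar_kind) : R -> scalar_field R k :=
  match k with RealScalars => fun x => x | ComplexScalars => fun x => x%:C%C end.

Definition abs_scalar (R : realType) (k : scalar_kind) : scalar_field R k -> R :=
  match k with
  | RealScalars => fun z => `|z|
  | ComplexScalars => fun z => complex.Re `|z|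
  end.

Section scalar_theory.
Variables (R : realType) (k : scalar_kind).
Implicit Types (x y : R) (z w : scalar_field R k).

Lemma abs_scalarE z : of_real k (abs_scalar z) = `|z|.
Proof. by case: k z => //= z; rewrite normc_def. Qed.

Lemma of_realD x y : of_real k (x + y) = of_real k x + of_real k y.
Proof. by case: k => //=; rewrite rmorphD. Qed.

Lemma of_realM x y : of_real k (x * y) = of_real k x * of_real k y.
Proof. by case: k => //=; rewrite rmorphM. Qed.

Lemma of_real_le x y : (of_real k x <= of_real k y) = (x <= y).
Proof. by case: k => //=; rewrite lecR. Qed.

Lemma of_real_inj : injective (@of_real R k).
Proof.
by move=> x y /eqP xy; apply/eqP; rewrite eq_le -!of_real_le; move/eqP: xy => ->;
   rewrite lexx.
Qed.

Lemma of_real0 : of_real k 0 = 0 :> scalar_field R k.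
Proof. by case: k. Qed.

Lemma of_real1 : of_real k 1 = 1 :> scalar_field R k.
Proof. by case: k. Qed.

Lemma abs_scalar_ge0 z : 0 <= abs_scalar z.
Proof. by rewrite -of_real_le of_real0 abs_scalarE. Qed.

Lemma abs_scalarM z w : abs_scalar (z * w) = abs_scalar z * abs_scalar w.
Proof. by apply: of_real_inj; rewrite of_realM !abs_scalarE normrM. Qed.

Lemma abs_scalarD z w : abs_scalar (z + w) <= abs_scalar z + abs_scalar w.
Proof. by rewrite -of_real_le of_realD !abs_scalarE ler_normD. Qed.

Lemma abs_scalar0 : abs_scalar (0 : scalar_field R k) = 0.
Proof. by apply: of_real_inj; rewrite abs_scalarE normr0 of_real0. Qed.

Lemma abs_scalar_eq0 z : abs_scalar z = 0 -> z = 0.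
Proof. by move=> z0; apply/normr0_eq0; rewrite -abs_scalarE z0 of_real0. Qed.

End scalar_theory.

Section ell2.
Variables (R : realType) (k : scalar_kind) (Gamma : choiceType).
Local Notation K := (scalar_field R k).
Implicit Types f g : Gamma -> K^o.

Definition sqsum f : \bar R :=
  \esum_(i in [set: Gamma]) ((abs_scalar (f i)) ^+ 2)%:E.

Lemma sqsum_ge0 f : (0 <= sqsum f)%E.
Proof. by apply: esum_ge0 => i _; rewrite lee_fin sqr_ge0. Qed.

Lemma sqsum_ge f i : (((abs_scalar (f i)) ^+ 2)%:E <= sqsum f)%E.
Proof.
apply: esum_ge; exists [set i]; first by split.
by rewrite fsbig_set1.
Qed.

Lemma sqsum0 : sqsum 0 = 0%E.
Proof. by apply: esum1 => i _; rewrite abs_scalar0 expr0n. Qed.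

Lemma sqsumZ_le (a : K) f :
  (sqsum (a *: f) <= ((abs_scalar a) ^+ 2)%:E * sqsum f)%E.
Proof.
apply: ge_ereal_sup => _ [X [finX XG]] <-.
under eq_fsbigr do rewrite /= abs_scalarM exprMn EFinM.
rewrite -ge0_mule_fsumr; last by move=> i; rewrite lee_fin sqr_ge0.
rewrite lee_wpmul2l ?lee_fin ?sqr_ge0//.
by apply: esum_ge; exists X.
Qed.

Lemma sqsumZ (a : K) f : sqsum (a *: f) = (((abs_scalar a) ^+ 2)%:E * sqsum f)%E.
Proof.
apply/eqP; rewrite eq_le sqsumZ_le /=.
have [->|a0] := eqVneq a 0.
  by rewrite abs_scalar0 expr0n mul0e sqsum_ge0.
have aV : a^-1 *: (a *: f) = f by rewrite scalerA mulVf// scale1r.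
have a1 : abs_scalar a * abs_scalar a^-1 = 1.
  apply: (@of_real_inj R k).
  by rewrite of_realM !abs_scalarE -normrM divff// normr1 of_real1.
rewrite -{1}aV.
apply: (le_trans (lee_wpmul2l _ (sqsumZ_le a^-1 (a *: f)))).
  by rewrite lee_fin sqr_ge0.
by rewrite muleA -EFinM -exprMn a1 expr1n mul1e.
Qed.

Lemma sqsumD_le (s t : R) f g : 0 < s -> 0 < t ->
  (sqsum (f + g)%R <= (1 + t / s)%:E * sqsum f + (1 + s / t)%:E * sqsum g)%E.
Proof.
move=> s0 t0; apply: ge_ereal_sup => _ [X [finX XG]] <-.
set u := 1 + t / s; set v := 1 + s / t.
have u0 : 0 <= u by rewrite addr_ge0// divr_ge0// ltW.
have v0 : 0 <= v by rewrite addr_ge0// divr_ge0// ltW.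
have le_sum h : (\sum_(i \in X) ((abs_scalar (h i)) ^+ 2)%:E <= sqsum h)%E.
  by apply: esum_ge; exists X.
apply: (@le_trans _ _ (u%:E * (\sum_(i \in X) ((abs_scalar (f i)) ^+ 2)%:E)
   + v%:E * (\sum_(i \in X) ((abs_scalar (g i)) ^+ 2)%:E))%E); last first.
  by apply: leeD; rewrite lee_wpmul2l// lee_fin.
rewrite !ge0_mule_fsumr; try by move=> i; rewrite lee_fin sqr_ge0.
rewrite -fsbig_split//=; apply: lee_fsum => // i _.
rewrite -!EFinM -EFinD lee_fin.
apply: (@le_trans _ _ ((abs_scalar (f i) + abs_scalar (g i)) ^+ 2)).
  by rewrite ler_sqr ?nnegrE ?addr_ge0 ?abs_scalar_ge0// abs_scalarD.
move: (abs_scalar (f i)) (abs_scalar (g i)) => a b.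
rewrite -subr_ge0 (_ : _ - _ = (t * a - s * b) ^+ 2 / (s * t)).
  by rewrite divr_ge0 ?sqr_ge0// mulr_ge0// ltW.
rewrite /u /v; field.
by rewrite !gt_eqF.
Qed.

Definition ell2_pred : {pred Gamma -> K^o} :=
  [in [set f : Gamma -> K^o | (sqsum f < +oo)%E]].

Lemma ell2_submod_closed : submod_closed ell2_pred.
Proof.
split=> [|a f g]; rewrite !inE /=; first by rewrite sqsum0.
move=> foo goo; apply: (le_lt_trans (sqsumD_le _ _ ltr01 ltr01)).
have c0 : 0 <= 1 + 1 / 1 :> R by rewrite addr_ge0// divr_ge0.
rewrite sqsumZ; apply: lte_add_pinfty; apply: lte_mul_pinfty; rewrite ?lee_fin//.
by apply: lte_mul_pinfty; rewrite ?lee_fin ?sqr_ge0.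
Qed.

HB.instance Definition _ :=
  GRing.isSubmodClosed.Build K (Gamma -> K^o) ell2_pred ell2_submod_closed.

Record ell2 := Ell2 { ell2_val :> Gamma -> K^o;
                      ell2_valP : ell2_val \in ell2_pred }.

HB.instance Definition _ := [isSub for ell2_val].
HB.instance Definition _ := [Choice of ell2 by <:].
HB.instance Definition _ := [SubChoice_isSubLmodule of ell2 by <:].

Definition ell2_rnorm (f : ell2) : R := Num.sqrt (fine (sqsum f)).
Definition ell2_norm (f : ell2) : K := of_real k (ell2_rnorm f).

Lemma sqsum_rnorm (f : ell2) : sqsum f = ((ell2_rnorm f) ^+ 2)%:E.
Proof.
have := ell2_valP f; rewrite inE /= => foo.
rewrite sqr_sqrtr ?fine_ge0 ?sqsum_ge0// fineK//.
by rewrite ge0_fin_numE ?sqsum_ge0.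
Qed.

Lemma ell2_rnorm_ge0 (f : ell2) : 0 <= ell2_rnorm f.
Proof. exact: sqrtr_ge0. Qed.

Lemma ell2_normD (f g : ell2) : ell2_norm (f + g) <= ell2_norm f + ell2_norm g.
Proof.
rewrite -of_realD of_real_le; apply/ler_addgt0Pr => e e0.
set s := ell2_rnorm f + e / 2; set t := ell2_rnorm g + e / 2.
have e20 : 0 < e / 2 by rewrite divr_gt0.
have s0 : 0 < s by rewrite ltr_wpDl// ell2_rnorm_ge0.
have t0 : 0 < t by rewrite ltr_wpDl// ell2_rnorm_ge0.
have -> : ell2_rnorm f + ell2_rnorm g + e = s + t by rewrite /s /t; field.
have st0 : 0 <= s + t by rewrite addr_ge0 ?(ltW s0) ?(ltW t0).
rewrite -ler_sqr ?nnegrE ?ell2_rnorm_ge0//.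
rewrite -lee_fin -sqsum_rnorm.
apply: (le_trans (sqsumD_le _ _ s0 t0)).
rewrite !sqsum_rnorm -!EFinM -EFinD lee_fin.
have -> : (s + t) ^+ 2 = (1 + t / s) * s ^+ 2 + (1 + s / t) * t ^+ 2.
  by field; rewrite !gt_eqF.
have ge1 (x y : R) : 0 < x -> 0 < y -> 0 <= 1 + x / y.
  by move=> /ltW x0 /ltW y0; rewrite addr_ge0// divr_ge0.
have le_sq h (x : R) : x = ell2_rnorm h + e / 2 -> ell2_rnorm h ^+ 2 <= x ^+ 2.
  move=> ->; rewrite ler_sqr ?nnegrE ?ell2_rnorm_ge0//; last first.
    by rewrite addr_ge0 ?ell2_rnorm_ge0// ltW.
  by rewrite lerDl ltW.
by apply: lerD; apply: ler_wpM2l; rewrite ?ge1// le_sq.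
Qed.

Lemma ell2_normZ (a : K) (f : ell2) : ell2_norm (a *: f) = `|a| * ell2_norm f.
Proof.
rewrite -abs_scalarE -of_realM; congr of_real.
apply/eqP; rewrite -(@eqrXn2 _ 2) ?mulr_ge0 ?ell2_rnorm_ge0 ?abs_scalar_ge0//.
apply/eqP/EFin_inj; rewrite -(sqsum_rnorm (a *: f)) exprMn EFinM -sqsum_rnorm.
exact: sqsumZ.
Qed.

Lemma ell2_norm_eq0 (f : ell2) : ell2_norm f = 0 -> f = 0.
Proof.
rewrite /ell2_norm -(of_real0 R k) => /of_real_inj f0.
apply: val_inj; apply/funext => i; apply: abs_scalar_eq0.
have := sqsum_ge f i; rewrite sqsum_rnorm f0 lee_fin expr0n /= => fi0.
by apply/eqP; rewrite -sqrf_eq0 eq_le fi0 sqr_ge0.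
Qed.

HB.instance Definition _ :=
  Lmodule_isNormed.Build K ell2 ell2_normD ell2_normZ ell2_norm_eq0.

Lemma ell2_normE (f : ell2) : `|f| =
  of_real k (Num.sqrt (fine (\esum_(i in [set: Gamma])
    ((abs_scalar (f i)) ^+ 2)%:E))).
Proof. by []. Qed.

End ell2.

(* Main.v *)
Require Import Defs.
From HB Require Import structures.
From mathcomp Require Import all_boot all_order all_algebra finmap.
From mathcomp Require Import all_classical all_reals all_analysis.
From mathcomp.real_closed Require Import complex.

Set Implicit Arguments.
Unset Strict Implicit.
Unset Printing Implicit Defensive.

Import Order.TTheory GRing.Theory Num.Theory.
Import numFieldNormedType.Exports.

Local Open Scope classical_set_scope.
Local Open Scope card_scope.
Local Open Scope ring_scope.

(* Let [B] be a Hamel basis of [W]. The vectors of [ell2] have countable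
   supports, so all the [S e], with [S] in [B] and [e] in a Hamel basis of [E],
   live on a set [G0] of coordinates with [card G0 < card Gamma], because
   [l * l = l] for every infinite cardinal [l]. The complement of [G0] thus
   contains [card Gamma] disjoint copies of [Gamma]. Composing a given operator
   that is not absolutely summing with the isometries onto these copies yields
   [card Gamma] operators to be added to [B]: if a linear combination [v] has a
   coefficient [c != 0] on the copy [a] of [T], then restricting to the
   coordinates of that copy gives [`|c *: T x| <= `|v x|], so that [v] is not
   absolutely summing either. *)

(** * Cardinal arithmetic *)

(* Unlike functions, relations also work when [U] is empty. *)
Lemma card_le_relP (T U : Type) (A : set T) (B : set U) :
  A #<= B <-> exists2 G : T -> U -> Prop,
    forall a, A a -> exists2 b, B b & G a b &
    forall a a' b, A a -> A a' -> G a b -> G a' b -> a = a'.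
Proof.
split=> [|[G Gtot Ginj]].
  (* An injective function on all of [T] needs a default value in [U], so an empty [U] is treated
     apart; then [A] is empty too. *)
  elim/Ppointed: U => U in B *.
    by rewrite !emptyE_subdef => ->; exists (fun _ _ => True).
  move=> /pcard_leP[f]; exists (fun a b => f a = b) => [a Aa|a a' b Aa Aa' <-].
    by exists (f a) => //; apply: funS.
  by move=> /esym; apply: 'inj_f; exact/mem_set.
have tot (a : set_type A) : {b : set_type B | G (val a) (val b)}.
  apply: cid; have [b Bb Gab] := Gtot _ (set_valP a).
  by exists (SigSub (mem_set Bb)).
apply/card_leP/injfunPex; exists (fun a => sval (tot a)) => // a a' _ _ eq_aa'.
apply/val_inj/(Ginj _ _ (val (sval (tot a)))); try exact: set_valP.
  exact: svalP (tot a).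
by rewrite eq_aa'; exact: svalP (tot a').
Qed.

(** Zorn's lemma gives a maximal graph of a partial injection from [A] to [B]. Either its domain is
    all of [A] or its range is all of [B]; otherwise a pair of missed points could be added. *)
Lemma card_le_total (T U : Type) (A : set T) (B : set U) : A #<= B \/ B #<= A.
Proof.
pose P (G : set (T * U)) := (forall p, G p -> A p.1 /\ B p.2) /\
  forall p q, G p -> G q -> p.1 = q.1 <-> p.2 = q.2.
have [F FP totF|G [[GAB Ginj] Gmax]] := @Zorn_bigcup (T * U) P.
  split=> [p [X FX Xp]|p q [X FX Xp] [Y FY Yq]]; first exact: (FP X FX).1.
  have [XY|YX] := totF _ _ FX FY.
    by apply: (FP Y FY).2 => //; exact: XY.
  by apply: (FP X FX).2 => //; exact: YX.
have [domG|/existsNP[a /not_implyP[Aa Na]]] :=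
    pselect (forall a, A a -> exists b, G (a, b)).
  left; apply/card_le_relP; exists (fun a b => G (a, b)) => [a /domG[b Gab]|].
    by exists b => //; exact: (GAB _ Gab).2.
  by move=> a a' b _ _ Gab Ga'b; exact/(Ginj _ _ Gab Ga'b).
have [ranG|/existsNP[b /not_implyP[Bb Nb]]] :=
    pselect (forall b, B b -> exists a, G (a, b)).
  right; apply/card_le_relP; exists (fun b a => G (a, b)) => [b /ranG[c Gcb]|].
    by exists c => //; exact: (GAB _ Gcb).1.
  by move=> b b' c _ _ Gcb Gcb'; exact/(Ginj _ _ Gcb Gcb').
exfalso; apply: (Gmax (G `|` [set (a, b)])).
  split=> [|/(_ (a, b))]; first by move=> p; left.
  by move=> Gab; apply: Na; exists b; apply: Gab; right.
split=> [p [/GAB//|-> //]|p q [Gp|->] [Gq|->] //=]; first exact: Ginj.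
- split=> eq_pq; [case: Na; exists p.2|case: Nb; exists p.1].
    by rewrite -eq_pq -surjective_pairing.
  by rewrite -eq_pq -surjective_pairing.
- split=> eq_pq; [case: Na; exists q.2|case: Nb; exists q.1].
    by rewrite eq_pq -surjective_pairing.
  by rewrite eq_pq -surjective_pairing.
Qed.

Lemma card_leX (T T' U U' : Type) (A : set T) (A' : set T') (B : set U)
    (B' : set U') : A #<= A' -> B #<= B' -> A `*` B #<= A' `*` B'.
Proof.
move=> /card_le_relP[G Gtot Ginj] /card_le_relP[H Htot Hinj].
apply/card_le_relP; exists (fun p q => G p.1 q.1 /\ H p.2 q.2).
  move=> p [/Gtot[a' A'a' Gp] /Htot[b' B'b' Hp]].
  by exists (a', b').
move=> [a b] [a' b'] [c d] /= [Aa Bb] [Aa' Bb'] [Gac Hbd] [Ga'c Hb'd].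
by rewrite (Ginj _ _ _ Aa Aa' Gac Ga'c) (Hinj _ _ _ Bb Bb' Hbd Hb'd).
Qed.

(** Two distinct points of [C] serve as tags, which embeds the union into [C * C]. The bound on
    [C * C] is an assumption here because the lemma is applied inside the proof of that bound for
    all infinite sets. *)
Lemma card_leU_sq (T U : Type) (A B : set T) (C : set U) :
  infinite_set C -> C `*` C #<= C -> A #<= C -> B #<= C -> A `|` B #<= C.
Proof.
move=> Cinf CC /card_le_relP[G Gtot Ginj] /card_le_relP[H Htot Hinj].
have /card_le_relP[N Ntot Ninj] : [set: nat] #<= C by exact/infiniteP.
have [x0 Cx0 Nx0] := Ntot 0%N I; have [x1 Cx1 Nx1] := Ntot 1%N I.
have x01 : x0 <> x1.
  by move=> e; have := Ninj _ _ x1 I I; rewrite -{1}e => /(_ _ _ Nx0 Nx1).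
apply: card_le_trans CC; apply/card_le_relP.
exists (fun a p => (A a /\ G a p.1 /\ p.2 = x0) \/
                   (~ A a /\ H a p.1 /\ p.2 = x1)).
  move=> a ABa; have [Aa|NAa] := pselect (A a).
    by have [b Cb Gab] := Gtot a Aa; exists (b, x0) => //; left.
  have Ba : B a by case: ABa.
  by have [b Cb Hab] := Htot a Ba; exists (b, x1) => //; right.
move=> a a' [b x] /= ABa ABa' [[Aa [Gab ->]]|[NAa [Hab ->]]].
  by move=> [[Aa' [Ga'b _]]|[_ [_]]//]; exact: (Ginj _ _ b).
move=> [[_ [_ /esym]]//|[NAa' [Ha'b _]]].
by apply: (Hinj _ _ b) => //; [case: ABa|case: ABa'].
Qed.

(* Zorn's lemma is applied to the graphs [G] of injections [X * X -> X] with
   [X `<=` A]; such an [X] is recovered from [G] as its diagonal domain [D G].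
   For a maximal [X], the complement [A `\` X] cannot contain a copy [Y] of [X],
   as [Y] would have room for the new pairs of [(X `|` Y) * (X `|` Y)]. *)
Lemma infinite_card_setXx (T : Type) (A : set T) :
  infinite_set A -> A `*` A #<= A.
Proof.
move=> Ainf.
pose D (G : set (T * T * T)) := [set x | exists z, G (x, x, z)].
(* The last clause is restricted to nonempty [G] because Zorn's lemma also asks for the union of the
   empty chain, which is the empty graph. *)
pose P (G : set (T * T * T)) := [/\
  forall x y z, G (x, y, z) -> [/\ D G x, D G y & D G z],
  forall x y, D G x -> D G y -> exists z, G (x, y, z),
  forall x y x' y' z, G (x, y, z) -> G (x', y', z) -> (x, y) = (x', y'),
  D G `<=` A &
  G !=set0 -> infinite_set (D G)].
have D_mono G G' : G `<=` G' -> D G `<=` D G' by move=> GG' x [z /GG']; exists z.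
(* The old values stay in [D G], and all the new pairs are sent into [Y], which is disjoint from
   [D G]; so injectivity is preserved. *)
have extend G Y : P G -> Y `<=` A -> Y !=set0 -> Y `<=` ~` D G ->
    infinite_set (D G `|` Y) -> (D G `|` Y) `*` (D G `|` Y) #<= Y ->
    exists2 G', G `<` G' & P G'.
  move=> [G1 G2 G3 G4 G5] YA [y0 Yy0] YG XYinf /card_le_relP[H Htot Hinj].
  pose G' := G `|` [set p | [/\ (D G `|` Y) p.1.1, (D G `|` Y) p.1.2,
    ~ (D G p.1.1 /\ D G p.1.2), Y p.2 & H p.1 p.2]].
  have new x y : (D G `|` Y) x -> (D G `|` Y) y -> ~ (D G x /\ D G y) ->
      exists z, G' (x, y, z).
    move=> XYx XYy Nxy; have [//|z Yz Hz] := Htot (x, y).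
    by exists z; right.
  have GG' : G `<=` G' by move=> p; left.
  have DG' : D G' = D G `|` Y.
    apply/seteqP; split=> [x [z [Gz|[]//]]|x].
      by left; exists z.
    move=> [|Yx]; first exact: D_mono.
    by apply: new; [right|right|move=> [/(YG _ Yx)]].
  exists G'.
    split=> // G'G; have [z /G'G Gz] : D G' y0 by rewrite DG'; right.
    by apply: (YG _ Yy0); exists z.
  split.
  - rewrite DG' => x y z [/G1[Gx Gy Gz]|[/= Gx Gy _ Yz _]].
      by split; left.
    by split=> //; right.
  - rewrite DG' => x y Gx Gy.
    have [[Dx Dy]|] := pselect (D G x /\ D G y); last exact: new.
    by have [z Gz] := G2 _ _ Dx Dy; exists z; left.
  - move=> x y x' y' z [Gz|[/= Gx Gy _ Yz Hz]] [Gz'|[/= Gx' Gy' _ Yz' Hz']].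
    + exact: G3 Gz Gz'.
    + by have [_ _ /(YG _ Yz')] := G1 _ _ _ Gz.
    + by have [_ _ /(YG _ Yz)] := G1 _ _ _ Gz'.
    + exact: Hinj Hz Hz'.
  - by rewrite DG' => x [/G4|/YA].
  - by rewrite DG'.
have [F FP totF|G [PG Gmax]] := @Zorn_bigcup _ P.
  have FD X : F X -> D X `<=` D (\bigcup_(X in F) X).
    by move=> FX; apply/D_mono/bigcup_sup.
  split.
  - move=> x y z [X FX Xz]; have [X1 _ _ _ _] := FP _ FX.
    by have [Dx Dy Dz] := X1 _ _ _ Xz; split; apply: FD FX _ _.
  - move=> x y [z [X FX Xz]] [t [Y FY Yt]].
    have [XY|YX] := totF _ _ FX FY.
      have [_ Y2 _ _ _] := FP _ FY.
      have [|u Yu] := Y2 x y _ (ex_intro _ t Yt); first by exists z; exact: XY.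
      by exists u, Y.
    have [_ X2 _ _ _] := FP _ FX.
    have [|u Xu] := X2 x y (ex_intro _ z Xz); first by exists t; exact: YX.
    by exists u, X.
  - move=> x y x' y' z [X FX Xz] [Y FY Yz].
    have [XY|YX] := totF _ _ FX FY.
      by have [_ _ Y3 _ _] := FP _ FY; apply: Y3 Yz => //; exact: XY.
    by have [_ _ X3 _ _] := FP _ FX; apply: X3 Xz _; exact: YX.
  - move=> x [z [X FX Xz]]; have [_ _ _ X4 _] := FP _ FX.
    by apply: X4; exists z.
  - move=> [p [X FX Xp]]; have [_ _ _ _ X5] := FP _ FX.
    by apply: sub_infinite_set (FD _ FX) _; apply: X5; exists p.
have [G1 G2 G3 G4 G5] := PG.
(* The empty graph is not maximal: a countably infinite subset of [A] carries an injection of its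
   square, by the pairing of natural numbers. *)
have G0 : G !=set0.
  apply/set0P/negP => /eqP G0.
  have DG0 : D G = set0 by rewrite G0; apply/seteqP; split=> // x [].
  have /card_le_relP[N Ntot Ninj] := (infiniteP A).1 Ainf.
  have /choice[f /= fP] n : exists a, A a /\ N n a.
    by have [//|a] := Ntot n; exists a.
  have finj : injective f.
    move=> m n emn; apply: (Ninj _ _ (f m)) => //; first exact: (fP m).2.
    by rewrite emn; exact: (fP n).2.
  have cf : [set: nat] #= range f.
    by rewrite card_eq_sym; apply: inj_card_eq => m n _ _ /finj.
  have [||||||G' GG' PG'] := extend G (range f).
  - exact: PG.
  - by move=> _ [n _ <-]; exact: (fP n).1.
  - by exists (f 0%N); exists 0%N.
  - by rewrite DG0 => x _.
  - by rewrite DG0 set0U; apply/infiniteP; rewrite -(card_le_eqr cf).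
  - rewrite DG0 set0U -(card_le_eqr cf).
    apply: card_le_trans (_ : [set: nat * nat] #<= _).
      by rewrite -setXTT; apply: card_leX; rewrite -(card_le_eql cf).
    by move: card_nat2; rewrite card_eq_le => /andP[].
  - exact: Gmax GG' PG'.
have Dinf := G5 G0.
have DD : D G `*` D G #<= D G.
  apply/card_le_relP; exists (fun p z => G (p, z)) => [[x y] [Dx Dy]|].
    have [z Gz] := G2 _ _ Dx Dy; exists z => //.
    by have [] := G1 _ _ _ Gz.
  by move=> [x y] [x' y'] z _ _; exact: G3.
(* In the first case [A] itself embeds into [D G], which absorbs its square; the second case
   contradicts maximality. *)
have [ADle|DAle] := card_le_total (A `\` D G) (D G).
  have AD : A #<= D G.
    apply: card_le_trans (card_leU_sq Dinf DD ADle (card_lexx _)).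
    apply: subset_card_le => x Ax.
    by have [Dx|NDx] := pselect (D G x); [right|left].
  apply: card_le_trans (card_leX AD AD) _; apply: card_le_trans DD _.
  exact: subset_card_le.
exfalso; have /card_le_relP[N Ntot Ninj] := DAle.
have /choice[f fP] (x : T) : exists a, D G x -> (A `\` D G) a /\ N x a.
  have [Dx|NDx] := pselect (D G x); last by exists x.
  by have [a Aa Na] := Ntot _ Dx; exists a.
have finj : {in D G &, injective f}.
  move=> x y /set_mem Dx /set_mem Dy exy.
  apply: (Ninj _ _ (f x)) => //; first exact: (fP x Dx).2.
  by rewrite exy; exact: (fP y Dy).2.
have fD : f @` D G #= D G by exact: inj_card_eq.
have [||||||G' GG' PG'] := extend G (f @` D G).
- exact: PG.
- by move=> _ [x Dx <-]; exact: (fP x Dx).1.1.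
- by have /infinite_setN0[x Dx] := Dinf; exists (f x); exists x.
- by move=> _ [x Dx <-]; exact: (fP x Dx).1.2.
- by apply: sub_infinite_set Dinf; left.
- rewrite (card_le_eqr fD); apply: (card_le_trans _ DD).
  have fDle : f @` D G #<= D G by rewrite (card_le_eql fD).
  by apply: card_leX; exact: card_leU_sq.
- exact: Gmax GG' PG'.
Qed.

Lemma card_leU (T U : Type) (A B : set T) (C : set U) :
  infinite_set C -> A #<= C -> B #<= C -> A `|` B #<= C.
Proof. by move=> Cinf; apply: card_leU_sq => //; exact: infinite_card_setXx. Qed.

(** A point of [F i] is coded by the pair of a code of [i] in [C] and its own code in [C], and
    [C * C] embeds into [C]. *)
Lemma card_le_bigcup (I T U : Type) (D : set I) (F : I -> set T) (C : set U) :
  infinite_set C -> D #<= C -> (forall i, D i -> F i #<= C) ->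
  \bigcup_(i in D) F i #<= C.
Proof.
move=> Cinf /card_le_relP[N Ntot Ninj] FC.
have /choice[H HP] (i : I) : exists G : T -> U -> Prop, D i ->
    (forall a, F i a -> exists2 c, C c & G a c) /\
    (forall a a' c, F i a -> F i a' -> G a c -> G a' c -> a = a').
  have [Di|NDi] := pselect (D i); last by exists (fun _ _ => True).
  by have /card_le_relP[G Gtot Ginj] := FC i Di; exists G.
apply: card_le_trans (infinite_card_setXx Cinf); apply/card_le_relP.
exists (fun a p => exists i, [/\ D i, N i p.1, F i a & H i a p.2]).
  move=> a [i Di Fia]; have [c Cc Nc] := Ntot i Di.
  by have [c' Cc' Hc'] := (HP i Di).1 a Fia; exists (c, c') => //; exists i.
move=> a a' [c c'] _ _ /= [i [Di Nic Fia Hia]] [j [Dj Njc Fja' Hja']].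
have eij := Ninj _ _ _ Di Dj Nic Njc; subst j.
exact: (HP i Di).2 Hia Hja'.
Qed.

Lemma card_le_lt_trans (T U V : Type) (A : set T) (B : set U) (C : set V) :
  A #<= B -> card_lt B C -> card_lt A C.
Proof.
move=> AB [BC BneC]; split; first exact: card_le_trans BC.
apply: contra BneC => AC; apply: Cantor_Bernstein => //.
by rewrite -(card_le_eql AC).
Qed.

Lemma card_lt_geF (T U : Type) (A : set T) (B : set U) :
  card_lt A B -> ~ (B #<= A).
Proof. by move=> [AB /negP AneB] BA; apply/AneB/Cantor_Bernstein. Qed.

(** The larger of [A] and its complement is infinite and absorbs the union, which is everything; by
    strictness it cannot be [A]. *)
Lemma card_lt_setC (T : Type) (A : set T) :
  infinite_set [set: T] -> card_lt A [set: T] -> [set: T] #<= ~` A.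
Proof.
move=> Tinf AT; have [AC|CA] := card_le_total A (~` A).
  have Cinf : infinite_set (~` A).
    move=> Cfin; apply: Tinf; rewrite -(setUv A) finite_setU.
    by split=> //; exact: card_le_finite AC Cfin.
  by rewrite -[X in X #<= _](setUv A); exact: card_leU.
have Ainf : infinite_set A.
  move=> Afin; apply: Tinf; rewrite -(setUv A) finite_setU.
  by split=> //; exact: card_le_finite CA Afin.
exfalso; apply: (card_lt_geF AT).
by rewrite -[X in X #<= _](setUv A); exact: card_leU.
Qed.

Lemma card_le_subset (T U : Type) (A : set T) (B : set U) :
  A #<= B -> exists2 P : set U, P `<=` B & P #= A.
Proof.
move=> /card_leP[f]; pose g (a : set_type A) := val (f a).
exists (range g); first by move=> _ [a _ <-]; exact: set_valP.
rewrite -(card_eqr (card_setT A)); apply: inj_card_eq => a b _ _ /val_inj.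
by apply: 'inj_f; exact/mem_set.
Qed.

(** [phi (a, j)] is meant as coordinate [j] of the copy indexed by [a]. The partial inverse [psi]
    makes it possible to define operators on the copies by case analysis. *)
Lemma exists_copies (Gamma : Type) (G0 : set Gamma) :
  infinite_set [set: Gamma] -> card_lt G0 [set: Gamma] ->
  exists (phi : Gamma * Gamma -> Gamma) (psi : Gamma -> option (Gamma * Gamma)),
    [/\ pcancel phi psi, ocancel psi phi & forall p, ~ G0 (phi p)].
Proof.
move=> Ginf G0lt.
have : [set: Gamma * Gamma] #<= ~` G0.
  apply: card_le_trans (card_lt_setC Ginf G0lt).
  by rewrite -setXTT; exact: infinite_card_setXx.
move=> /card_le_relP[N Ntot Ninj].
have /choice[phi phiP] p : exists i, ~ G0 i /\ N p i.
  by have [//|i G0i Ni] := Ntot p; exists i.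
have phi_inj : injective phi.
  move=> p q epq; apply: (Ninj _ _ (phi p)) => //; first exact: (phiP p).2.
  by rewrite epq; exact: (phiP q).2.
have /choice[psi psiP] i : exists o : option (Gamma * Gamma),
    oapp (fun p => phi p = i) (~ range phi i) o.
  have [[p _ pi]|Ni] := pselect (range phi i); first by exists (Some p).
  by exists None.
exists phi, psi; split=> [p|i|p]; last exact: (phiP p).1.
  have := psiP (phi p); case: (psi (phi p)) => /= [q /phi_inj -> //|].
  by case; exists p.
by have := psiP i; case: (psi i).
Qed.

(** * Linear spans, scalars and series *)

Section linear_span.
Variables (K : fieldType) (V : lmodType K).
Implicit Types B : set V.

Lemma lin_span_subspace B : Defs.subspace (lin_span B).
Proof.
split=> [|a u v].
  by rewrite inE; exists fset0, (fun=> 0); split=> [x|]; rewrite ?big_seq_fset0.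
rewrite !inE => -[F [c [FB ->]]] [G [d [GB ->]]].
(* Both combinations are rewritten over the union of their supports, with zero coefficients on the
   added vectors. *)
have widen (A A' : {fset V}) (e : V -> K) : (A `<=` A')%fset ->
    \sum_(x <- A) e x *: x =
    \sum_(x <- A') (if x \in A then e x else 0) *: x.
  move=> AA'; rewrite -(big_fset_incl _ AA') => [|x _ /negbTE ->].
    by apply: eq_big_seq => x ->.
  by rewrite scale0r.
rewrite (widen _ _ _ (fsubsetUl F G)) (widen _ _ _ (fsubsetUr F G)).
exists (F `|` G)%fset, (fun x => a * (if x \in F then c x else 0) +
                                 (if x \in G then d x else 0)).
split=> [x /=|]; first by rewrite inE => /orP[/FB|/GB].
rewrite scaler_sumr -big_split; apply: eq_bigr => x _ /=.
by rewrite scalerDl scalerA.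
Qed.

Lemma lin_span_mono B B' : B `<=` B' -> lin_span B `<=` lin_span B'.
Proof.
move=> BB' _ [F [c [FB ->]]]; exists F, c; split=> //.
exact: subset_trans BB'.
Qed.

End linear_span.

Section scalar_series.
Variables (R : realType) (k : scalar_kind).

Lemma cvg_of_real (u : nat -> R) :
  cvgn (fun n => of_real k (u n) : (scalar_field R k)^o) <-> cvgn u.
Proof.
case: k => //=; split=> /cvg_ex[l ul]; apply/cvg_ex.
  (* The complex limit is not known to be real; its real part works, since taking real parts does
     not increase the modulus. *)
  exists (complex.Re l); apply/cvgrPdist_lt => e e0.
  move/cvgrPdist_lt : ul => /(_ e%:C%C); rewrite ltcR => /(_ e0).
  apply: filterS => n; rewrite -ltcR; apply: le_lt_trans.
  by rewrite (le_trans _ (normc_ge_Re _))// lecR; case: (l).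
exists l%:C%C; apply/cvgrPdist_lt => -[e e'].
(* A positive complex radius has zero imaginary part. *)
rewrite ltcE /= => /andP[/eqP -> e0].
move/cvgrPdist_lt : ul => /(_ _ e0); apply: filterS => n.
by rewrite -ltcR -rmorphB normc_def /= expr0n addr0 sqrtr_sqr.
Qed.

Lemma series_of_real (u : nat -> R) :
  series (fun n => of_real k (u n)) = (fun n => of_real k (series u n)).
Proof.
apply/funext => n; rewrite /series /=.
elim/big_ind2 : _ => [||//]; first by rewrite of_real0.
by move=> x a y b -> ->; rewrite of_realD.
Qed.

End scalar_series.

(** * Absolutely summing operators into [ell2] *)

Section ell2_theory.
Variables (R : realType) (k : scalar_kind) (Gamma : choiceType).
Local Notation K := (scalar_field R k).
Local Notation H := (ell2 R k Gamma).
Implicit Types f g : Gamma -> K^o.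

Lemma abs_scalar_neq0 (z : K) : z != 0 -> 0 < abs_scalar z.
Proof.
move=> z0; rewrite lt_neqAle abs_scalar_ge0 andbT eq_sym.
by apply: contra z0 => /eqP/abs_scalar_eq0 ->.
Qed.

(** The support is the union over [n] of the sets where the squared modulus is at least
    [1 / (n + 1)], and each of these is finite because the squares are summable. *)
Lemma countable_support (f : H) : countable [set i | f i != 0].
Proof.
pose S n := [set i | n.+1%:R^-1 <= abs_scalar (f i) ^+ 2].
have -> : [set i | f i != 0] = \bigcup_n S n.
  apply/seteqP; split=> [i /= /abs_scalar_neq0 fi|i [n _]].
    have fi2 : 0 < abs_scalar (f i) ^+ 2 by rewrite exprn_gt0.
    exists (Num.truncn (abs_scalar (f i) ^+ 2)^-1) => //.
    by rewrite /S /= invf_ple ?posrE// ltW// truncnS_gt.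
  apply: contraTneq => ->; rewrite abs_scalar0 expr0n /= -ltNge.
  by rewrite invr_gt0.
apply: bigcup_countable => // n _; apply: finite_set_countable.
apply: contrapT => /infinite_set_fset Sinf.
(* More than [M] indices, each contributing at least [1 / (n + 1)], would exceed the squared
   norm. *)
set M := ell2_rnorm f ^+ 2 * n.+1%:R.
have [B BS cardB] := Sinf (Num.truncn M).+1.
have : (((Num.truncn M).+1%:R * n.+1%:R^-1)%:E <= sqsum f)%E.
  apply: esum_ge; exists [set` B]; first by split=> //; exact: finite_fset.
  rewrite fsbig_finite; last exact: finite_fset.
  rewrite set_fsetK sumEFin lee_fin.
  apply: (@le_trans _ _ (\sum_(i <- B) n.+1%:R^-1)).
    rewrite big_const_seq count_predT iter_addr_0 -[leRHS]mulr_natl ler_wpM2r//.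
    by rewrite ler_nat.
  by rewrite big_seq [leRHS]big_seq; apply: ler_sum => i iB; exact: BS.
rewrite sqsum_rnorm lee_fin ler_pdivrMr// => /le_lt_trans/(_ (truncnS_gt _)).
by rewrite ltxx.
Qed.

Lemma sqsum_comp_le (e : Gamma -> Gamma) f :
  injective e -> (sqsum (f \o e) <= sqsum f)%E.
Proof.
move=> einj; rewrite /sqsum.
rewrite -(esum_image [set: Gamma] e (fun j => (abs_scalar (f j) ^+ 2)%:E)).
  rewrite esum_mkcond; apply: le_esum => i _.
  by case: ifP => // _; rewrite lee_fin sqr_ge0.
by move=> i j _ _; exact: einj.
Qed.

Lemma sqsum_comp (e : Gamma -> Gamma) f : injective e ->
  (forall i, ~ range e i -> f i = 0) -> sqsum (f \o e) = sqsum f.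
Proof.
move=> einj f0; rewrite /sqsum.
rewrite -(esum_image [set: Gamma] e (fun j => (abs_scalar (f j) ^+ 2)%:E)).
  rewrite esum_mkcond; apply: eq_esum => i _.
  case: ifPn => // /negP; rewrite inE => /f0 ->.
  by rewrite abs_scalar0 expr0n.
by move=> i j _ _; exact: einj.
Qed.

Lemma ell2_rnorm_le (f g : H) :
  (sqsum f <= sqsum g)%E -> ell2_rnorm f <= ell2_rnorm g.
Proof.
by rewrite !sqsum_rnorm lee_fin ler_sqr ?nnegrE ?ell2_rnorm_ge0.
Qed.

Lemma ell2_rnormZ (a : K) (f : H) :
  ell2_rnorm (a *: f) = abs_scalar a * ell2_rnorm f.
Proof.
by apply: (@of_real_inj R k); rewrite of_realM abs_scalarE -ell2_normZ.
Qed.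

(** Passing from scalar-valued norms to real ones makes the comparison test for real series
    available. *)
Lemma absolutely_summing_rnormP (E : normedModType K) (S : contlin E H) :
  absolutely_summing S <-> forall x : nat -> E,
    (forall phi : contlin E K^o, cvgn (series (fun j => `|phi (x j)|))) ->
    cvgn (series (fun j => ell2_rnorm (S (x j)))).
Proof.
have seriesE (x : nat -> E) : cvgn (series (fun j => `|S (x j)|)) <->
    cvgn (series (fun j => ell2_rnorm (S (x j)))).
  by rewrite -(cvg_of_real k) -series_of_real.
by split=> sumS x /sumS /seriesE.
Qed.

Lemma absolutely_summing_dominated (E : normedModType K) (S T : contlin E H)
    (c : K) :
  c != 0 -> (forall x, ell2_rnorm (c *: T x) <= ell2_rnorm (S x)) ->
  absolutely_summing S -> absolutely_summing T.
Proof.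
move=> c0 leTS /absolutely_summing_rnormP sumS.
apply/absolutely_summing_rnormP => x /sumS sumSx.
have c0' := abs_scalar_neq0 c0.
have /is_cvg_seriesZ - /(_ (abs_scalar c)^-1) :
    cvgn (series (fun j => abs_scalar c * ell2_rnorm (T (x j)))).
  by apply: series_le_cvg sumSx => n; rewrite -?ell2_rnormZ ?ell2_rnorm_ge0.
rewrite (_ : _ *: _ = fun j => ell2_rnorm (T (x j)))//.
by apply/funext => n; apply: mulKf; rewrite gt_eqF.
Qed.

Lemma absolutely_summing0 (E : normedModType K) :
  absolutely_summing (0 : contlin E H).
Proof.
move=> x _; rewrite (_ : series _ = fun=> 0); first exact: is_cvg_cst.
by apply/funext => n; rewrite /series /= big1// => j _; rewrite normr0.
Qed.

End ell2_theory.

(** * Isometric copies of an operator on disjoint sets of coordinates *)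

Section ell2_copies.
Variables (R : realType) (k : scalar_kind) (Gamma : choiceType).
Variables (phi : Gamma * Gamma -> Gamma) (psi : Gamma -> option (Gamma * Gamma)).
Hypotheses (phiK : pcancel phi psi) (psiK : ocancel psi phi).
Local Notation K := (scalar_field R k).
Local Notation H := (ell2 R k Gamma).

(** This transports [f] to the slice [phi (a, _)] and extends it by zero, both on the other slices
    and outside the range of [phi]. *)
Definition copy_fun (a : Gamma) (f : Gamma -> K^o) : Gamma -> K^o :=
  fun i => if psi i is Some p then if p.1 == a then f p.2 else 0 else 0.

Lemma copy_fun_phi a f b j :
  copy_fun a f (phi (b, j)) = if b == a then f j else 0.
Proof. by rewrite /copy_fun phiK. Qed.

Lemma copy_fun_out a f i : ~ range phi i -> copy_fun a f i = 0.
Proof.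
rewrite /copy_fun; case psii : (psi i) => [p|//] []; exists p => //.
by have := psiK i; rewrite psii.
Qed.

Lemma phi_inj : injective phi. Proof. exact: pcan_inj phiK. Qed.

Lemma phi_slice_inj a : injective (fun j => phi (a, j)).
Proof. by move=> i j /phi_inj[]. Qed.

Lemma sqsum_copy a f : sqsum (copy_fun a f) = sqsum f.
Proof.
rewrite -(@sqsum_comp _ _ _ (fun j => phi (a, j))).
- by congr sqsum; apply/funext => j; rewrite /= copy_fun_phi eqxx.
- exact: phi_slice_inj.
- move=> i Ni; have [[[b j] _ phibj]|/copy_fun_out//] := pselect (range phi i).
  rewrite -phibj copy_fun_phi; case: eqP => // ba; case: Ni.
  by exists j => //; rewrite -ba.
Qed.

Lemma copy_subproof a (f : H) : copy_fun a f \in @ell2_pred R k Gamma.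
Proof. by have := ell2_valP f; rewrite !inE /= sqsum_copy. Qed.

Definition copy a (f : H) : H := Ell2 (copy_subproof a f).

Lemma copy_phi a f b j : copy a f (phi (b, j)) = if b == a then f j else 0.
Proof. exact: copy_fun_phi. Qed.

Lemma copy_linear a : linear (copy a).
Proof.
move=> c f g; apply/val_inj/funext => i.
rewrite -[RHS]/(c * copy a f i + copy a g i) /= /copy_fun.
case: (psi i) => [p|]; last by rewrite mulr0 addr0.
by case: ifP => _; rewrite ?mulr0 ?addr0.
Qed.

Lemma copy_norm a f : `|copy a f| = `|f|.
Proof. by rewrite /Num.norm /= /ell2_norm /ell2_rnorm sqsum_copy. Qed.

Variable E : normedModType K.

Lemma copy_op_subproof a (T : contlin E H) :
  copy a \o T \in @contlin_pred K E H.
Proof.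
rewrite inE; split=> [c x y|x]; first by rewrite /= contlin_linear copy_linear.
have /cvgrPdist_lt Tx := @contlin_continuous _ _ _ T x.
apply/cvgrPdist_lt => e /Tx; apply: filterS => y /=.
suff -> : copy a (T x) - copy a (T y) = copy a (T x - T y) by rewrite copy_norm.
by rewrite addrC -scaleN1r -copy_linear scaleN1r addrC.
Qed.

Definition copy_op (T : contlin E H) (a : Gamma) : contlin E H :=
  ContLin (copy_op_subproof a T).

Lemma copy_op_phi T a y b j :
  copy_op T a y (phi (b, j)) = if b == a then T y j else 0.
Proof. exact: copy_phi. Qed.

(** On the coordinates of copy [a], the operator [copy_op T a] shows [T], whereas [copy_op T b]
    vanishes for [b != a]. *)
Lemma copy_op_inj T : T != 0 -> injective (copy_op T).
Proof.
move=> T0 a b eq_ab; apply: contraNeq T0 => ab.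
apply/eqP/val_inj/funext => y; apply/val_inj/funext => j.
have := copy_op_phi T a y a j.
by rewrite eq_ab copy_op_phi eqxx (negbTE ab) => /esym.
Qed.

Lemma contlin_sumE (F : {fset contlin E H}) (c : contlin E H -> K) y i :
  (\sum_(T <- F) c T *: T) y i = \sum_(T <- F) c T * T y i.
Proof.
have ev0 : (0 : contlin E H) y i = 0 by [].
have evZ (b : K) (S : contlin E H) : (b *: S) y = b *: S y by [].
have evZ' (b : K) (f : H) : (b *: f) i = b * f i by [].
have evD (S S' : contlin E H) : (S + S') y i = S y i + S' y i by [].
rewrite (@big_morph _ _ (fun S : contlin E H => S y i) 0 +%R 0 +%R evD ev0).
by apply: eq_bigr => S _; rewrite evZ evZ'.
Qed.

Variables (T : contlin E H) (B : set (contlin E H)) (P : set Gamma).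
Hypotheses (NT : ~ absolutely_summing T)
  (B_phi : forall S y p, B S -> S y (phi p) = 0).

Let C := B `|` copy_op T @` P.

(** Restricting the values of the sum to the coordinates of the copy [S] leaves exactly
    [c S *: T y]. Restriction does not increase the norm, so absolute summability would pass to
    [T]. *)
Lemma not_absolutely_summing_copy (F : {fset contlin E H})
    (c : contlin E H -> K) S :
  [set` F] `<=` C -> S \in F -> ~ B S -> c S != 0 ->
  ~ absolutely_summing (\sum_(S <- F) c S *: S).
Proof.
move=> FC SF NBS cS; apply: contra_not NT.
have [/NBS[]|[a Pa aS]] := FC S SF.
apply: (absolutely_summing_dominated cS) => y; apply: ell2_rnorm_le.
(* Operators in [B] vanish on every copy, and a copy of index [b] vanishes on slice [a] unless
   [a = b], which would make it equal to [S]. *)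
have coord j : (\sum_(S <- F) c S *: S) y (phi (a, j)) = c S * T y j.
  rewrite contlin_sumE (big_fsetD1 S) //= -{2}aS copy_op_phi eqxx.
  rewrite big1_seq ?addr0//.
  move=> S'; rewrite !inE => /and3P[_ S'S /FC[/B_phi ->|[b Pb bS']]].
    by rewrite mulr0.
  rewrite -bS' copy_op_phi; case: eqP => [ab|_]; last by rewrite mulr0.
  by move: S'S; rewrite -bS' -aS ab eqxx.
have -> : c S *: T y =
    (\sum_(S <- F) c S *: S) y \o (fun j => phi (a, j)) :> (Gamma -> K^o).
  by apply/funext => j; rewrite [RHS]coord.
exact/sqsum_comp_le/phi_slice_inj.
Qed.

(** The zero operator is absolutely summing, so in a vanishing combination every coefficient outside
    [B] is zero; what remains is a relation in [B]. *)
Lemma lin_independent_copy : lin_independent B -> lin_independent C.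
Proof.
move=> Bfree F c FC sum0 S SF; apply/eqP; apply: contrapT => /negP cS.
have cF0 S' : S' \in F -> ~ B S' -> c S' = 0.
  move=> S'F NBS'; apply/eqP; apply: contrapT => /negP cS'.
  have := not_absolutely_summing_copy FC S'F NBS' cS'.
  by rewrite sum0; apply; exact: absolutely_summing0.
have BS : B S by apply: contrapT => /(cF0 _ SF)/eqP; rewrite (negbTE cS).
pose FB := [fset S in F | S \in B]%fset.
apply/negP: cS; rewrite negbK; apply/eqP; apply: (Bfree FB).
- by move=> S' /=; rewrite !inE /= => /andP[_] /set_mem.
- rewrite (big_fset_incl _ (fset_sub _ _)) ?sum0// => S' S'F.
  rewrite !inE S'F /= => /negP; rewrite inE => /(cF0 _ S'F) ->.
  by rewrite scale0r.
- by rewrite !inE /= SF /= inE.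
Qed.

(** If some coefficient outside [B] is nonzero, the combination is not absolutely summing; otherwise
    it already lies in the span of [B]. *)
Lemma lin_span_copy : lin_span B `<=` ~` @Pi1 K E H `|` [set 0] ->
  lin_span C `<=` ~` @Pi1 K E H `|` [set 0].
Proof.
move=> BA _ [F [c [FC ->]]].
have [[S [SF NBS cS]]|cF0] :=
    pselect (exists S, [/\ S \in F, ~ B S & c S != 0]).
  by left; exact: not_absolutely_summing_copy cS.
apply: BA; exists [fset S in F | S \in B]%fset, c; split.
  by move=> S' /=; rewrite !inE /= => /andP[_] /set_mem.
apply/esym/big_fset_incl; first exact: fset_sub.
move=> S SF; rewrite !inE SF /= => /negP; rewrite inE => NBS.
have [->|cS] := eqVneq (c S) 0; first by rewrite scale0r.
by case: cF0; exists S.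
Qed.

End ell2_copies.

(** * Enlarging an independent family by copies, and the lineability theorem *)

Section extension.
Variables (R : realType) (k : scalar_kind) (Gamma : choiceType).
Local Notation K := (scalar_field R k).
Local Notation H := (ell2 R k Gamma).
Variable E : normedModType K.
Local Notation A := (~` @Pi1 K E H).

(** This serves both halves of the theorem: empty [B] and [G0] with [P] of cardinality [alpha] for
    lineability, and a basis [B] of the given subspace with full [P] for the extension. *)
Lemma exists_independent_copies (B : set (contlin E H)) (G0 P : set Gamma) :
  infinite_set [set: Gamma] -> card_lt G0 [set: Gamma] -> A !=set0 ->
  (forall S y i, B S -> ~ G0 i -> S y i = 0) ->
  lin_independent B -> lin_span B `<=` A `|` [set 0] ->
  exists C, [/\ C #= P, lin_independent (B `|` C) &
                lin_span (B `|` C) `<=` A `|` [set 0]].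
Proof.
move=> Ginf G0lt [T NT] B0 Bfree BA.
have [phi [psi [phiK psiK phi0]]] := exists_copies Ginf G0lt.
have B_phi S y p : B S -> S y (phi p) = 0 by move=> BS; exact: B0.
exists (copy_op phiK psiK T @` P); split.
- apply: inj_card_eq => a b _ _; apply: copy_op_inj.
  by apply/eqP => T0; apply: NT; rewrite T0; exact: absolutely_summing0.
- exact: lin_independent_copy.
- exact: lin_span_copy.
Qed.

Lemma contlin_coord_span (BE : set E) (S : contlin E H) i :
  lin_span BE = [set: E] -> (forall e, BE e -> S e i = 0) ->
  forall y, S y i = 0.
Proof.
move=> BEspan Se0 y; have : lin_span BE y by rewrite BEspan.
move=> [F [c [FBE ->]]]; rewrite linear_sum.
rewrite (@big_morph _ _ (fun f : H => f i) 0 +%R 0 +%R)//.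
rewrite big1_seq// => e /FBE BEe; rewrite linearZ.
by rewrite -[LHS]/(c e * S e i) Se0 ?mulr0.
Qed.

End extension.

Theorem proposition3p2 (R : realType) (k : scalar_kind)
    (E : completeNormedModType (scalar_field R k)) (Gamma : choiceType)
    (hE : infinite_dim E)
    (hc : card_lt [set: R] [set: Gamma])
    (hdim : dim_lt E Gamma)
    (hne : ~` @Pi1 (scalar_field R k) E (ell2 R k Gamma) !=set0)
    (alpha : Type) (halpha : card_lt [set: alpha] [set: Gamma]) :
  lineable2 alpha Gamma (~` @Pi1 (scalar_field R k) E (ell2 R k Gamma)).
Proof.
have [BE BEbasis BElt] := hdim.
have BEinf : infinite_set BE by move=> BEfin; apply: hE; exists BE.
have Ginf : infinite_set [set: Gamma].
  by move=> Gfin; apply: BEinf; exact: card_le_finite BElt.1 Gfin.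
split=> [|W Wsub WA [B [Bfree BW] Balpha]].
  have [P _ Palpha] := card_le_subset halpha.1.
  have lt0 : card_lt (@set0 Gamma) [set: Gamma].
    split=> //; rewrite card_eq_sym card_eq0.
    by apply/eqP => G0; apply: Ginf; rewrite G0; exact: finite_set0.
  have free0 : lin_independent (@set0 (contlin E (ell2 R k Gamma))).
    by move=> F c F0 _ S /F0.
  have span0 : lin_span set0 `<=` ~` @Pi1 _ E (ell2 R k Gamma) `|` [set 0].
    by move=> _ [F [c [F0 ->]]]; right; rewrite /= big1_seq// => S /F0.
  have [C []] := exists_independent_copies P Ginf lt0 hne
    (fun _ _ _ => False_ind _) free0 span0.
  rewrite set0U => CP Cfree CA; exists (lin_span C); split=> //.
    exact: lin_span_subspace.
  by exists C => //; exact: card_eq_trans Palpha.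
(* These are the coordinates reached by [B] on basis vectors of [E]; by linearity, [B] vanishes at
   all others on the whole of [E]. *)
pose G0 := \bigcup_(S in B) \bigcup_(e in BE) [set i | S e i != 0].
(* [D] will be the larger of [B] and [BE]. It is infinite because [BE] is, so it absorbs this double
   union of countable supports. *)
have G0le (U : Type) (D : set U) :
    infinite_set D -> B #<= D -> BE #<= D -> G0 #<= D.
  move=> Dinf BD BED; apply: card_le_bigcup => // S _.
  apply: card_le_bigcup => // e _.
  by apply: card_le_trans (countable_support (S e)) _; exact/infiniteP.
have Blt : card_lt B [set: Gamma].
  by apply: card_le_lt_trans halpha; move: Balpha; rewrite card_eq_le => /andP[].
have G0lt : card_lt G0 [set: Gamma].
  have [BBE|BEB] := card_le_total B BE.
    by apply: card_le_lt_trans BElt; exact: G0le.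
  apply: card_le_lt_trans Blt; apply: G0le => // Bfin.
  by apply: BEinf; exact: card_le_finite BEB Bfin.
have G00 S y i : B S -> ~ G0 i -> S y i = 0.
  move=> BS NG0i; apply: contlin_coord_span BEbasis.2 _ _ => e BEe.
  apply/eqP; apply: contrapT => /negP Sei; apply: NG0i.
  by exists S => //; exists e.
have BA : lin_span B `<=` ~` @Pi1 _ E (ell2 R k Gamma) `|` [set 0].
  by rewrite BW.
have [C [CG BCfree BCA]] :=
  exists_independent_copies [set: Gamma] Ginf G0lt hne G00 Bfree BA.
exists (lin_span (B `|` C)); split=> //.
- exact: lin_span_subspace.
- exists (B `|` C) => //; move: CG; rewrite !card_eq_le => /andP[CG GC].
  rewrite card_leU //=; last exact: Blt.1.
  by apply: card_le_trans GC _; apply: subset_card_le; right.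
- by rewrite -BW; apply: lin_span_mono; left.
Qed.
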